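(* Let $A=(a_{i,j}),B=(b_{i,j})\in PL_3$ be CPLM with PLC $A_1$ and $B_1$, respectively. If $B$ is a leading CPLM, then $C=A\cdot B$ is a CPLM with PLC $A_1\cdot B_1$. Further, writing $C=(c_{i,j})$, $c_{i,1}=a_{i,1}$ for all $1\le i\le 3$.
   Context: Matrices have entries in a field $k$. A $d\times d$ matrix is a Permutation-Like Matrix (PLM) if all its entries are $0$ or $1$ and each column contains exactly one entry equal to $1$; $PL_d$ is the set of all $d\times d$ PLM. $A\in PL_3$ is a canonical Permutation-Like Matrix (CPLM) if $a_{1,2}=a_{1,3}=0$ and the $2\times 2$ submatrix $A_1=(a_{i,j})_{2\le i,j\le 3}$ lies in $PL_2$; $A_1$ is called the Permutation-Like Component (PLC) of $A$. A CPLM $A$ is leading if $a_{1,1}=1$. *)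

(* Defs.v *)
From mathcomp Require Import all_boot all_order all_algebra.

Set Implicit Arguments.
Unset Strict Implicit.
Unset Printing Implicit Defensive.

Import GRing.Theory.
Local Open Scope ring_scope.

(* Rows and columns are numbered from 0, so the entry a_{i,j} of the 1-based
   mathematical notation is A (i-1) (j-1); numerals of type 'I_3 are read
   through its Z/3 ring structure. *)

Definition PLM (k : fieldType) (d : nat) (A : 'M[k]_d) : Prop :=
  (forall i j, A i j = 0 \/ A i j = 1) /\
  (forall j, exists! i, A i j = 1).

Definition PLC (k : fieldType) (A : 'M[k]_3) : 'M[k]_2 := row' 0 (col' 0 A).

Definition CPLM (k : fieldType) (A : 'M[k]_3) : Prop :=
  [/\ PLM A, A 0 1 = 0, A 0 2 = 0 & PLM (PLC A)].

Definition leading_CPLM (k : fieldType) (A : 'M[k]_3) : Prop :=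
  CPLM A /\ A 0 0 = 1.

(* Main.v *)
Require Import Defs.
From mathcomp Require Import all_boot all_order all_algebra.
Import GRing.Theory.
Local Open Scope ring_scope.

(** Each column of a PLM [B] is a standard basis vector, so every column of [A *m B] is a copy of a
    column of [A] ([mulmx_PLM_col]). Hence PLMs are closed under product ([PLM_mul]), and
    [B 0 0 = 1] makes the first column of the product that of [A]. CPLMs are block lower triangular,
    so their lower-right blocks multiply ([PLC_mul]). *)

Lemma PLM_col (k : fieldType) (d : nat) (B : 'M[k]_d) (i0 j : 'I_d) :
  PLM B -> B i0 j = 1 -> forall i, B i j = (i == i0)%:R.
Proof.
move=> [B01 Bcol] Bi0 i; case: eqP => [-> // | ne_i].
case: (B01 i j) => // Bi; have [l [_ l_uniq]] := Bcol j.
by case: ne_i; rewrite -(l_uniq i Bi) -(l_uniq i0 Bi0).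
Qed.

Lemma mulmx_PLM_col (k : fieldType) (m d : nat) (A : 'M[k]_(m, d))
    (B : 'M[k]_d) (i0 j : 'I_d) :
  PLM B -> B i0 j = 1 -> forall i, (A *m B) i j = A i i0.
Proof.
move=> plB Bi0 i; rewrite mxE (bigD1 i0) //= Bi0 mulr1 big1 ?addr0 // => l ne_l.
by rewrite (PLM_col _ _ _ _ _ plB Bi0) (negPf ne_l) mulr0.
Qed.

Lemma PLM_mul (k : fieldType) (d : nat) (A B : 'M[k]_d) :
  PLM A -> PLM B -> PLM (A *m B).
Proof.
move=> [A01 Acol] plB.
have colE j : exists i0, forall i, (A *m B) i j = A i i0.
  by have [i0 [Bi0 _]] := plB.2 j; exists i0; apply: mulmx_PLM_col.
split=> [i j | j]; have [i0 ABj] := colE j; first by rewrite ABj; apply: A01.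
have [i [Ai i_uniq]] := Acol i0.
by exists i; split=> [| i']; rewrite ABj // => /i_uniq.
Qed.

(** The sum for an entry of the lower-right block exceeds the block product only by the term through
    index 0, which the zeros in the top row of [B] kill. *)
Lemma PLC_mul (k : fieldType) (A B : 'M[k]_3) :
  B 0 1 = 0 -> B 0 2 = 0 -> PLC (A *m B) = PLC A *m PLC B.
Proof.
move=> B01 B02; apply/matrixP=> i j.
have B0j : B 0 (lift 0 j) = 0.
  (* [lift 0 j] equals the numeral 1 or 2 of ['I_3] only up to its bound proof, hence [val_inj]. *)
  by case: j => [[|[|//]] ltj]; [rewrite -[RHS]B01 | rewrite -[RHS]B02];
    congr (B _ _); apply: val_inj.
rewrite !mxE big_ord_recl B0j mulr0 add0r.
by apply: eq_bigr => l _; rewrite !mxE.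
Qed.

Theorem proposition3p6 (k : fieldType) (A B : 'M[k]_3)
  (hA : CPLM A) (hB : leading_CPLM B) :
  [/\ CPLM (A *m B),
      PLC (A *m B) = PLC A *m PLC B &
      forall i : 'I_3, (A *m B) i 0 = A i 0].
Proof.
have [plA A01 A02 plcA] := hA; have [[plB B01 B02 plcB] B00] := hB.
(* In the sum over [l], the term [l = 0] dies by [B 0 j = 0], the other two by the zeros in the top
   row of [A]. *)
have AB0j j : B 0 j = 0 -> (A *m B) 0 j = 0.
  move=> B0j; rewrite mxE big1 // => -[[|[|[|//]]] ltl] _.
  - by rewrite [X in B X _](_ : _ = 0) ?B0j ?mulr0 //; apply: val_inj.
  - by rewrite [X in A _ X](_ : _ = 1) ?A01 ?mul0r //; apply: val_inj.
  - by rewrite [X in A _ X](_ : _ = 2) ?A02 ?mul0r //; apply: val_inj.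
(* Leadingness enters here: [B00] puts the 1 of column 0 of [B] in row 0. *)
have plcAB := PLC_mul _ A B B01 B02; split=> //; last exact: mulmx_PLM_col.
split; [exact: PLM_mul | exact: AB0j | exact: AB0j |].
by rewrite plcAB; apply: PLM_mul.
Qed.
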